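(* Let $\alpha\in\mathbb{Q}\cap(0,1/2)$ with $\alpha\neq 1/3$, and let $e_1,\dots,e_n$ be the interior edges of the funnel $F_\alpha$. The assignments $$z_j=\mathcal{Z}(e_j)\in\mathbb{Q}(x),\qquad j=1,\dots,n,$$ are a solution in the field $\mathbb{Q}(x)$ of the gluing equations for the Sakuma--Weeks triangulation of $M_\alpha^\circ$ given by $F_\alpha$.
   Context: Farey notation. $\mathbb{Q}_0=\mathbb{Q}\cap[0,1]$, $\widehat{\mathbb{Q}}_0=\mathbb{Q}_0\cup\{\infty\}$; fractions are in lowest terms with positive denominator, $0=0/1$, $1=1/1$, $\infty=1/0$. A pair $\{p/q,r/s\}\subset\widehat{\mathbb{Q}}_0$ is a Farey pair if $ps-rq=\pm1$; $p/q\oplus r/s=(p+r)/(q+s)$; $\gamma\oplus^0\beta=\gamma$ and $\gamma\oplus^j\beta=(\gamma\oplus^{j-1}\beta)\oplus\beta$. Edges. $\mathcal{E}$ is the set of Farey pairs $e\subset\mathbb{Q}_0$ (edges of the Stern--Brocot diagram), with endpoints $e^L<e^R$. The edge $\{0,1\}$ is called horizontal; for it $\nu(e)=1$ and $\hat e=\infty$. For any other edge, $e^-$ and $e^+$ are the endpoints with smaller and larger denominator, $\hat e\in\mathbb{Q}_0$ is determined by $\hat e\oplus e^-=e^+$, and $\nu(e)=-1$ if $e^-=e^L$, $\nu(e)=1$ if $e^-=e^R$. Polynomials. $d_{\mathcal Q}(p/q)=(-1)^px^q$. $\mathcal{Q}:\widehat{\mathbb{Q}}_0\to\mathbb{Z}[x]$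 is the unique function with $\mathcal{Q}(0)=1$, $\mathcal{Q}(\infty)=0$, $\mathcal{Q}(1)=1$ and $\mathcal{Q}(\gamma\oplus^2\beta)=-d_{\mathcal Q}(\beta)\mathcal{Q}(\gamma)+\mathcal{Q}(\beta)\mathcal{Q}(\gamma\oplus\beta)$ for every Farey pair $\{\beta,\gamma\}$ with $\gamma\oplus^2\beta\in\mathbb{Q}_0$. The shape parameter function $\mathcal{Z}:\mathcal{E}\to\mathbb{Q}(x)$ is $$\mathcal{Z}(e)=-d_{\mathcal Q}(\hat e)^{-\nu(e)}\left(\frac{\mathcal{Q}(e^L)}{\mathcal{Q}(e^R)}\right)^2 .$$ Funnel. For $\alpha\in\mathbb{Q}\cap(0,1/2)$, $\alpha\ne1/3$, the funnel $F_\alpha$ has edges $e_0,\dots,e_{n+1}$ crossed by a vertical ray falling to $\alpha$: $e_0=\{0,1\}$; given $e_j$, let $c=e_j^L\oplus e_j^R$; if $c=\alpha$ stop and set $j=n+1$; if $\alpha<c$ then $e_{j+1}=\{e_j^L,c\}$; if $\alpha>c$ then $e_{j+1}=\{c,e_j^R\}$. The interior edges are $e_1,\dots,e_n$ ($n\ge1$). The vertices of $F_\alpha$ are the endpoints of the $e_j$; those of the form $e_j^L$ are on the left side, those of the form $e_j^R$ on the right side. Gluing equations. $M_\alpha^\circ$ is the tangle complement triangulated by $n$ pairs of ideal tetrahedra $\Delta_1,\dots,\Delta_n$ (one pair for each interior edge of $F_\alpha$), whose edges are labeled by vertices of $F_\alpha$; $z_j$ is the common shape parameter of the two tetrahedra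 of $\Delta_j$ (structures invariant under the Klein 4-group of simplicial involutions are considered). Put $\zeta(t)=1/(1-t)$, $\zeta^2=\zeta\circ\zeta$, and $z_0=1$. There is one gluing equation for every edge not on the boundary of $M_\alpha^\circ$, up to the symmetry group, namely the following. (i) For each vertex $\beta$ of $F_\alpha$ which is not an endpoint of $e_0$ or $e_{n+1}$ and is different from $\hat e_{n+1}$: if $k$ and $\ell$ are the smallest and largest indices of interior edges having $\beta$ as an endpoint, then $1=z_{k-1}z_{\ell+1}\big(\prod_{j=k}^{\ell}\zeta(z_j)\big)^2$ if $\beta$ is on the left side, and $1=z_{k-1}z_{\ell+1}\big(\prod_{j=k}^{\ell}\zeta^2(z_j)\big)^2$ if $\beta$ is on the right side. (ii) For the upper tunnel (the edge labeled by both $0$ and $1$), provided $0$ is not an endpoint of $e_{n+1}$ and $0\ne\hat e_{n+1}$: $-1=z_1z_{\ell+1}\big(\prod_{j=1}^{\ell}\zeta(z_j)\big)^2$, where $\ell$ is the largest index with $e_\ell^-=0$. *)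

(* Defs.v *)
From HB Require Import structures.
From mathcomp Require Import all_boot all_order all_algebra.
From mathcomp Require Import zify ring lra.
Set Implicit Arguments.
Unset Strict Implicit.
Unset Printing Implicit Defensive.
Import Order.TTheory GRing.Theory Num.Theory.
Local Open Scope ring_scope.

(* Q together with infinity; None is infinity = 1/0. *)
Definition Qhat := option rat.

Definition num (u : Qhat) : int := if u is Some r then numq r else 1.
Definition den (u : Qhat) : int := if u is Some r then denq r else 0.

Definition frac (p q : int) : Qhat :=
  if q == 0 then None else Some (p%:~R / q%:~R).

Definition in_Q0 (u : Qhat) : bool :=
  if u is Some r then 0 <= r <= 1 else false.
Definition in_Qhat0 (u : Qhat) : bool :=
  if u is Some r then 0 <= r <= 1 else true.

Definition farey_pair (u v : Qhat) : bool :=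
  [&& in_Qhat0 u, in_Qhat0 v & `|num u * den v - num v * den u| == 1].

Definition oplus (u v : Qhat) : Qhat := frac (num u + num v) (den u + den v).
Definition oplus_iter (j : nat) (g b : Qhat) : Qhat :=
  iter j (fun u => oplus u b) g.

Definition mediant (a b : rat) : rat :=
  (numq a + numq b)%:~R / (denq a + denq b)%:~R.

Lemma oplusE (a b : rat) : oplus (Some a) (Some b) = Some (mediant a b).
Proof.
rewrite /oplus /frac /=.
by rewrite gt_eqF // addr_gt0 // denq_gt0.
Qed.

(* The edge {a, b} with a < b is the ordered pair (a, b). *)
Definition edge := (rat * rat)%type.
Definition edgeL (e : edge) : rat := e.1.
Definition edgeR (e : edge) : rat := e.2.
Definition is_edge (e : edge) : bool :=
  [&& 0 <= edgeL e, edgeL e < edgeR e, edgeR e <= 1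
    & farey_pair (Some (edgeL e)) (Some (edgeR e))].
Definition endpoint (b : rat) (e : edge) : bool :=
  (b == edgeL e) || (b == edgeR e).
Definition horizontal : edge := (0, 1).

(* Only meaningful for edges other than [horizontal]. *)
Definition edge_minus (e : edge) : rat :=
  if denq (edgeL e) < denq (edgeR e) then edgeL e else edgeR e.
Definition edge_plus (e : edge) : rat :=
  if denq (edgeL e) < denq (edgeR e) then edgeR e else edgeL e.

(* For a non-horizontal edge this is the solution of hat (+) e^- = e^+;
   see [hat_spec]. *)
Definition hat (e : edge) : Qhat :=
  if e == horizontal then None
  else frac (numq (edge_plus e) - numq (edge_minus e))
            (denq (edge_plus e) - denq (edge_minus e)).

Definition nu (e : edge) : int :=
  if e == horizontal then 1
  else if edge_minus e == edgeL e then -1 else 1.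

Definition dQ (u : Qhat) : {poly int} := (-1) ^+ `|num u|%N * 'X^`|den u|%N.

(* The conditions characterizing the polynomials Q(p/q); the values of Q outside
   [in_Qhat0] are unconstrained and never used. *)
Definition is_calQ (Q : Qhat -> {poly int}) : Prop :=
  [/\ Q (Some 0) = 1, Q None = 0, Q (Some 1) = 1 &
      forall b g : Qhat, farey_pair b g -> in_Q0 (oplus_iter 2 g b) ->
        Q (oplus_iter 2 g b) = - dQ b * Q g + Q b * Q (oplus g b)].

Definition Qx : fieldType := {fraction {poly rat}}.
Definition toQx (p : {poly int}) : Qx :=
  FracField.tofrac (map_poly (intr : int -> rat) p).

Definition shapeZ (Q : Qhat -> {poly int}) (e : edge) : Qx :=
  - toQx (dQ (hat e)) ^ (- nu e)
  * (toQx (Q (Some (edgeL e))) / toQx (Q (Some (edgeR e)))) ^+ 2.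

(* The edges e_0, e_1, ... of the funnel; the sequence is only meaningful up to
   the index at which it stops. *)
Fixpoint funnel_edge (alpha : rat) (j : nat) : edge :=
  if j is i.+1 then
    let e := funnel_edge alpha i in
    let c := mediant (edgeL e) (edgeR e) in
    if alpha < c then (edgeL e, c) else (c, edgeR e)
  else horizontal.

Definition funnel_mediant (alpha : rat) (j : nat) : rat :=
  mediant (edgeL (funnel_edge alpha j)) (edgeR (funnel_edge alpha j)).

(* e_m is the last edge of the funnel. *)
Definition funnel_last (alpha : rat) (m : nat) : Prop :=
  funnel_mediant alpha m = alpha /\
  forall j : nat, (j < m)%N -> funnel_mediant alpha j <> alpha.

Section Gluing.
Variables (F : fieldType) (alpha : rat) (n : nat).
Local Notation e := (funnel_edge alpha).

Definition zeta (t : F) : F := 1 / (1 - t).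
Definition zeta2 (t : F) : F := zeta (zeta t).

Definition left_vertex (b : rat) : Prop :=
  exists2 j : nat, (j <= n.+1)%N & b = edgeL (e j).
Definition right_vertex (b : rat) : Prop :=
  exists2 j : nat, (j <= n.+1)%N & b = edgeR (e j).

Definition smallest_index (P : nat -> bool) (k : nat) : Prop :=
  [/\ (1 <= k <= n)%N, P k & forall j : nat, (1 <= j <= n)%N -> P j -> (k <= j)%N].
Definition largest_index (P : nat -> bool) (l : nat) : Prop :=
  [/\ (1 <= l <= n)%N, P l & forall j : nat, (1 <= j <= n)%N -> P j -> (j <= l)%N].

Definition vertex_equations (z : nat -> F) : Prop :=
  forall (b : rat) (k l : nat),
    ~~ endpoint b (e 0) -> ~~ endpoint b (e n.+1) -> Some b != hat (e n.+1) ->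
    smallest_index (fun j => endpoint b (e j)) k ->
    largest_index (fun j => endpoint b (e j)) l ->
    (left_vertex b ->
       1 = z k.-1 * z l.+1 * (\prod_(k <= j < l.+1) zeta (z j)) ^+ 2) /\
    (right_vertex b ->
       1 = z k.-1 * z l.+1 * (\prod_(k <= j < l.+1) zeta2 (z j)) ^+ 2).

Definition upper_tunnel_equation (z : nat -> F) : Prop :=
  forall l : nat,
    ~~ endpoint 0 (e n.+1) -> Some 0 != hat (e n.+1) ->
    largest_index (fun j => edge_minus (e j) == 0) l ->
    -1 = z 1%N * z l.+1 * (\prod_(1 <= j < l.+1) zeta (z j)) ^+ 2.

(* The unknowns are z_1, ..., z_n. The first condition says that zeta (z j) and
   zeta2 (z j) are defined in F, division by 0 being total in MathComp. *)
Definition gluing_solution (z : nat -> F) : Prop :=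
  let z' := fun j : nat => if j == 0%N then 1 else z j in
  [/\ forall j : nat, (1 <= j <= n)%N -> z j != 0 /\ z j != 1,
      vertex_equations z' & upper_tunnel_equation z'].

End Gluing.

(* Consistency of the definitions above: [hat] solves its defining equation,
   the funnel is finite with edges in E, and [is_calQ] is satisfiable. *)

Lemma frac_numden (p q r s : int) :
  0 <= q -> p * s - r * q = 1 \/ p * s - r * q = -1 -> (q = 0 -> p = 1) ->
  num (frac p q) = p /\ den (frac p q) = q.
Proof.
move=> q0 bez pinf; rewrite /frac; case: (eqVneq q 0) => [q_0|qn0] /=.
  by rewrite q_0 pinf.
have cop : coprime `|p| `|q|.
  have: coprimez p q.
    apply/coprimezP; case: bez => h.
      by exists (s, - r) => /=; lia.
    by exists (- s, r) => /=; lia.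
  by rewrite coprimezE.
have qp : 0 < q by lia.
by rewrite coprimeq_num // coprimeq_den // (negPf qn0) gtr0_sg // mul1r gtr0_norm.
Qed.

Lemma frac_num_den (u : Qhat) : frac (num u) (den u) = u.
Proof.
by case: u => [r|] //=; rewrite /frac gt_eqF ?denq_gt0 // divq_num_den.
Qed.

Lemma numden_inj (u v : Qhat) : num u = num v -> den u = den v -> u = v.
Proof. by move=> h k; rewrite -(frac_num_den u) h k frac_num_den. Qed.

Lemma den_ge0 (u : Qhat) : 0 <= den u.
Proof. by case: u => //= r; rewrite ltW // denq_gt0. Qed.

Lemma in_Qhat0_num (u : Qhat) : in_Qhat0 u ->
  (den u = 0 /\ num u = 1) \/ [/\ 0 < den u, 0 <= num u & num u <= den u].
Proof.
case: u => [r|] /=; last by left.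
move=> /andP[r0 r1]; right; split=> //; rewrite ?denq_gt0 ?numq_ge0 //.
have dp : (0 : rat) < (denq r)%:~R by rewrite ltr0z denq_gt0.
by move: r1; rewrite -{1}(divq_num_den r) ler_pdivrMr // mul1r ler_int.
Qed.

Lemma farey_pairP (u v : Qhat) : farey_pair u v ->
  num u * den v - num v * den u = 1 \/ num u * den v - num v * den u = -1.
Proof. by move=> /and3P[_ _ /eqP h]; lia. Qed.

Lemma oplus_numden (u v : Qhat) :
  num u * den v - num v * den u = 1 \/ num u * den v - num v * den u = -1 ->
  num (oplus u v) = num u + num v /\ den (oplus u v) = den u + den v.
Proof.
move=> bez.
have u0 := den_ge0 u; have v0 := den_ge0 v.
apply: (@frac_numden _ _ (num v) (den v)); first by lia.
  by case: bez => h; [left|right]; rewrite -h; ring.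
move=> h; have [hu hv] : den u = 0 /\ den v = 0 by lia.
by rewrite hu hv !mulr0 in bez; case: bez.
Qed.

Lemma rat_lt_cross (a b : rat) :
  (a < b) = (numq a * denq b < numq b * denq a).
Proof.
have da : (0 : rat) < (denq a)%:~R by rewrite ltr0z denq_gt0.
have db : (0 : rat) < (denq b)%:~R by rewrite ltr0z denq_gt0.
rewrite -{1}(divq_num_den a) -{1}(divq_num_den b).
by rewrite ltr_pdivrMr // mulrAC ltr_pdivlMr // -!intrM ltr_int.
Qed.

Lemma edge_det (e : edge) : is_edge e ->
  numq (edgeR e) * denq (edgeL e) - numq (edgeL e) * denq (edgeR e) = 1.
Proof.
move=> /and4P[_ lt _ /farey_pairP /= h].
by move: lt; rewrite rat_lt_cross; lia.
Qed.

Lemma edge_num (e : edge) : is_edge e ->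
  [/\ 0 <= numq (edgeL e), numq (edgeL e) <= denq (edgeL e),
      0 <= numq (edgeR e) & numq (edgeR e) <= denq (edgeR e)].
Proof.
move=> /and4P[_ _ _ /and3P[/in_Qhat0_num hL /in_Qhat0_num hR _]].
have dL := denq_gt0 (edgeL e); have dR := denq_gt0 (edgeR e).
rewrite /= in hL hR; case: hL => [[h _]|[_ nL lL]]; first by lia.
by case: hR => [[h _]|[_ nR lR]]; first by lia.
Qed.

Lemma num_le_of_det (a b c d : int) : 0 < b -> b < d -> 0 <= a -> 0 <= c ->
  c * b - a * d = 1 \/ c * b - a * d = -1 -> a <= c.
Proof.
move=> b0 bd a0 c0 det; case: (leP a c) => // ca; exfalso.
have h1 : c * b <= (a - 1) * b by apply: ler_wpM2r; lia.
have h2 : a * (b + 1) <= a * d by apply: ler_wpM2l; lia.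
by rewrite mulrBl mulrDr in h1 h2; lia.
Qed.

Lemma hat_spec (e : edge) : is_edge e -> e <> horizontal ->
  in_Q0 (hat e) /\ oplus (hat e) (Some (edge_minus e)) = Some (edge_plus e).
Proof.
move=> ee nh; have det := edge_det ee; have [L0 L1 R0 R1] := edge_num ee.
have dL := denq_gt0 (edgeL e); have dR := denq_gt0 (edgeR e).
have dne : denq (edgeL e) <> denq (edgeR e).
  move=> h; apply: nh; case: e ee det L0 L1 R0 R1 dL dR h => a b /= ee.
  move=> det L0 L1 R0 R1 dL dR h.
  rewrite h -mulrBl in det.
  have pos : 1 <= numq b - numq a by nia.
  have d1 : denq b = 1 by nia.
  have da1 : denq a = 1 by lia.
  have na : numq a = 0 by rewrite d1 in det; lia.
  have nb : numq b = 1 by rewrite d1 in det; lia.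
  by rewrite -(divq_num_den a) -(divq_num_den b) d1 da1 na nb.
rewrite /hat; case: eqP => // _.
set m := edge_minus e; set p := edge_plus e.
have dm : 0 < denq m by exact: denq_gt0.
have [dmp bez [m0 m1 p0 p1]] : [/\ denq m < denq p,
    (numq p * denq m - numq m * denq p = 1 \/
     numq p * denq m - numq m * denq p = -1) &
    [/\ 0 <= numq m, numq m <= denq m, 0 <= numq p & numq p <= denq p]].
  rewrite /m /p /edge_minus /edge_plus.
  by case: (ltP (denq (edgeL e)) (denq (edgeR e))) => h; split; by [lia|split].
have bez2 : (numq p - numq m) * denq m - numq m * (denq p - denq m) = 1 \/
            (numq p - numq m) * denq m - numq m * (denq p - denq m) = -1.
  by case: bez => <-; [left|right]; ring.
have [] := @frac_numden (numq p - numq m) (denq p - denq m) (numq m) (denq m).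
- by lia.
- exact: bez2.
- by lia.
move=> hn hd; split.
  rewrite /frac subr_eq0 gt_eqF //= -!rmorphB /=.
  have dp : (0 : rat) < (denq p - denq m)%:~R by rewrite ltr0z; lia.
  rewrite ler_pdivlMr // ler_pdivrMr // mul0r mul1r ler0z ler_int.
  have h1 := @num_le_of_det (numq m) _ (numq p) _ dm dmp m0 p0 bez.
  have bez3 : (denq p - numq p) * denq m - (denq m - numq m) * denq p = 1 \/
              (denq p - numq p) * denq m - (denq m - numq m) * denq p = -1.
    by case: bez => h; [right|left]; lia.
  have h2 : denq m - numq m <= denq p - numq p.
    by apply: (num_le_of_det dm dmp _ _ bez3); lia.
  have h3 : 0 <= numq p - numq m <= denq p - denq m by lia.
  exact: h3.
by rewrite /oplus hn hd /= !subrK /frac gt_eqF ?denq_gt0 // divq_num_den.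
Qed.

Lemma mediant_edge (e : edge) : is_edge e ->
  let c := mediant (edgeL e) (edgeR e) in
  [/\ numq c = numq (edgeL e) + numq (edgeR e),
      denq c = denq (edgeL e) + denq (edgeR e),
      is_edge (edgeL e, c) & is_edge (c, edgeR e)].
Proof.
move=> ee c; have det := edge_det ee; have [L0 L1 R0 R1] := edge_num ee.
have dL := denq_gt0 (edgeL e); have dR := denq_gt0 (edgeR e).
have /and4P[l0 lt r1 fp] := ee.
have [] := oplus_numden (farey_pairP fp); rewrite oplusE /= -/c => nc dc.
have Lc : edgeL e < c by rewrite rat_lt_cross nc dc; lia.
have cR : c < edgeR e by rewrite rat_lt_cross nc dc; lia.
have c0 : 0 <= c by lra.
have c1 : c <= 1 by lra.
split=> //; apply/and4P; split=> //=; rewrite ?nc ?dc; try lra.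
  by apply/and3P; split=> /=; [lra|lra|]; rewrite nc dc; apply/eqP; lia.
by apply/and3P; split=> /=; [lra|lra|]; rewrite nc dc; apply/eqP; lia.
Qed.

Lemma funnel_edgeP (alpha : rat) (m : nat) : 0 < alpha < 1 ->
  (forall j : nat, (j < m)%N -> funnel_mediant alpha j <> alpha) ->
  let e := funnel_edge alpha m in
  [/\ is_edge e, edgeL e < alpha < edgeR e
    & m%:Z < denq (edgeL e) + denq (edgeR e)].
Proof.
move=> a01; elim: m => [|m IH] ne /=; first by split; rewrite //= ?a01.
have [|ee /andP[La aR] mle] := IH; first by move=> j jm; apply: ne; lia.
have := ne m (ltnSn m); rewrite /funnel_mediant.
set e := funnel_edge alpha m in ee La aR mle *.
have /= [nc dc e1 e2] := mediant_edge ee.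
have dL := denq_gt0 (edgeL e); have dR := denq_gt0 (edgeR e).
set c := mediant _ _ in nc dc e1 e2 * => cne.
case: (ltrgtP alpha c) => [h|h|h]; last by case: cne.
  by split=> //=; [apply/andP; split|rewrite dc; lia].
by split=> //=; [apply/andP; split|rewrite dc; lia].
Qed.

Lemma funnel_last_ex (alpha : rat) : 0 < alpha < 1 ->
  exists m : nat, funnel_last alpha m.
Proof.
move=> a01; pose P m := funnel_mediant alpha m == alpha.
have exP : exists m, P m.
  case: (boolP (has P (iota 0 `|denq alpha|.+1))) => [/hasP[m _ h]|].
    by exists m.
  move=> /hasPn nP; have [j jm|ee /andP[La aR] dle] :=
      @funnel_edgeP alpha `|denq alpha| a01.
    by apply/eqP/nP; rewrite mem_iota; lia.
  have det := edge_det ee.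
  have dL := denq_gt0 (edgeL (funnel_edge alpha `|denq alpha|)).
  have dR := denq_gt0 (edgeR (funnel_edge alpha `|denq alpha|)).
  have da := denq_gt0 alpha.
  exfalso; move: La aR dle dL dR det; rewrite !rat_lt_cross; set L := edgeL _;
    set R := edgeR _ => La aR dle dL dR det.
  have : denq alpha = denq R * (numq alpha * denq L - numq L * denq alpha)
                    + denq L * (numq R * denq alpha - numq alpha * denq R).
    by rewrite -[LHS]mulr1 -det; ring.
  have : 1 <= numq alpha * denq L - numq L * denq alpha by lia.
  have : 1 <= numq R * denq alpha - numq alpha * denq R by lia.
  by nia.
exists (ex_minn exP); case: ex_minnP => m /eqP hm mn; split=> // j jm h.
by have := mn j; rewrite /P h eqxx => /(_ isT); lia.
Qed.

Lemma oplus_iter2_numden (b g : Qhat) : farey_pair b g ->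
  [/\ num (oplus g b) = num g + num b, den (oplus g b) = den g + den b,
      num (oplus_iter 2 g b) = num g + 2 * num b
    & den (oplus_iter 2 g b) = den g + 2 * den b].
Proof.
move=> /farey_pairP fp.
have [|n1 d1] := @oplus_numden g b; first by case: fp; lia.
have [|n2 d2] := @oplus_numden (oplus g b) b.
  by rewrite n1 d1 !mulrDl !mulrDr; case: fp; lia.
by split=> //; rewrite /oplus_iter /= ?n2 ?d2 ?n1 ?d1; lia.
Qed.

Lemma in_Q0_num (u : Qhat) : in_Q0 u ->
  [/\ in_Qhat0 u, 0 < den u, 0 <= num u & num u <= den u].
Proof.
case: u => // r h; have := @in_Qhat0_num (Some r) h => /=.
by have := denq_gt0 r => d0 [[e _]|[d1 n0 n1]]; [lia|split].
Qed.

Lemma num_in_Qhat0 (u : Qhat) : 0 <= num u -> num u <= den u -> in_Qhat0 u.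
Proof.
case: u => //= r n0 n1; have dp : (0 : rat) < (denq r)%:~R.
  by rewrite ltr0z denq_gt0.
rewrite -numq_ge0 n0 /= -[r in r <= 1]divq_num_den ler_pdivrMr // mul1r.
by rewrite ler_int.
Qed.

Lemma parent_den (b g : Qhat) : farey_pair b g -> in_Q0 (oplus_iter 2 g b) ->
  0 < den b.
Proof.
move=> fp /in_Q0_num[_]; have [_ _ -> ->] := oplus_iter2_numden fp.
have /and3P[/in_Qhat0_num hb /in_Qhat0_num hg _] := fp.
case: hb => [[db nb]|[]] //; move: (farey_pairP fp); rewrite db nb.
by case: hg => [[-> ->]|[]]; lia.
Qed.

Lemma small_multiple (q k x : int) : `|x| < q -> x = q * k -> x = 0.
Proof.
move=> xq xe; suff k0 : k = 0 by rewrite xe k0 mulr0.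
have [k1|k1|] := ltrgtP k 0 => //.
  have : q * k <= q * -1 by apply: ler_wpM2l; lia.
  lia.
have : q * 1 <= q * k by apply: ler_wpM2l; lia.
lia.
Qed.

Lemma parent_num_unique (p q r s r' s' : int) :
  0 < s -> 0 < s' -> 2 * s <= q -> 2 * s' <= q ->
  (2 * s = q -> p - 2 * r = 1) -> (2 * s' = q -> p - 2 * r' = 1) ->
  p * s - r * q = 1 \/ p * s - r * q = -1 ->
  p * s' - r' * q = 1 \/ p * s' - r' * q = -1 ->
  r = r' /\ s = s'.
Proof.
move=> s0 s0' sq sq' b b' det det'.
have q0 : 0 < q by lia.
have cross : s * (p * s' - r' * q) - s' * (p * s - r * q)
             = q * (s' * r - s * r') by ring.
have same : s = s' -> r = r' /\ s = s'.
  move=> ss; split=> //; subst s'.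
  have e1 : (p * s - r' * q) - (p * s - r * q) = q * (r - r') by ring.
  have [e2|e2] : p * s - r' * q = p * s - r * q \/ 2 = q * `|r - r'|.
    have : q * (r - r') = 0 \/ q * (r - r') = 2 \/ q * (r - r') = -2 by lia.
    case=> [e|[e|e]]; first by left; lia.
      right; have : 0 < r - r' by nia.
      by move=> h; rewrite gtr0_norm.
    right; have : r - r' < 0 by nia.
    by move=> h; rewrite ltr0_norm // mulrN e.
  - have : q * (r - r') = 0 by rewrite -e1 e2 subrr.
    by move/eqP; rewrite mulf_eq0 => /orP[|] /eqP; lia.
  - have k1 : 1 <= `|r - r'|.
      by case: (eqVneq (r - r') 0) e2 => [-> | ? ?]; [rewrite normr0 mulr0|lia].
    have qk : q * 1 <= q * `|r - r'| by apply: ler_wpM2l; lia.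
    have q2 : 2 * s = q by lia.
    by have := b q2; have := b' q2; lia.
case: det => d; case: det' => d'; rewrite d d' in cross.
- have := @small_multiple q (s' * r - s * r') (s - s').
  move=> h; apply: same; have : s - s' = 0 by apply: h; lia.
  lia.
- have [lt|ge] : s + s' < q \/ s + s' = q by lia.
    by have : s + s' = 0; [apply: (@small_multiple q (s * r' - s' * r)); lia|lia].
  by apply: same; lia.
- have [lt|ge] : s + s' < q \/ s + s' = q by lia.
    by have : s + s' = 0; [apply: (@small_multiple q (s' * r - s * r')); lia|lia].
  by apply: same; lia.
- have := @small_multiple q (s * r' - s' * r) (s - s').
  move=> h; apply: same; have : s - s' = 0 by apply: h; lia.
  lia.
Qed.

Lemma parent_unique (b g b' g' : Qhat) : farey_pair b g -> farey_pair b' g' ->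
  in_Q0 (oplus_iter 2 g b) -> oplus_iter 2 g b = oplus_iter 2 g' b' -> b = b'.
Proof.
move=> fp fp' inu uu'; have db := parent_den fp inu.
have db' : 0 < den b' by apply: (parent_den fp'); rewrite -uu'.
have [_ _ nu du] := oplus_iter2_numden fp.
have [_ _ nu' du'] := oplus_iter2_numden fp'.
rewrite -uu' in nu' du'; set u := oplus_iter 2 g b in nu du nu' du'.
have /and3P[_ /in_Qhat0_num hg _] := fp.
have /and3P[_ /in_Qhat0_num hg' _] := fp'.
have bez := farey_pairP fp; have bez' := farey_pairP fp'.
have [] := @parent_num_unique (num u) (den u) (num b) (den b) (num b') (den b').
- exact: db.
- exact: db'.
- by have := den_ge0 g; lia.
- by have := den_ge0 g'; lia.
- by case: hg => [[? ?]|[? ? ?]]; lia.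
- by case: hg' => [[? ?]|[? ? ?]]; lia.
- by rewrite nu du !mulrDl !mulrDr; lia.
- by rewrite nu' du' !mulrDl !mulrDr; lia.
exact: numden_inj.
Qed.

Definition parent_of (u b : Qhat) : Qhat :=
  frac (num u - 2 * num b) (den u - 2 * den b).
Definition is_parent (u b : Qhat) : bool :=
  farey_pair b (parent_of u b) && (oplus_iter 2 (parent_of u b) b == u).
Definition find_parent (u : Qhat) : option Qhat :=
  ohead [seq b <- [seq frac (r : nat)%:Z (s : nat)%:Z
                    | s <- iota 0 `|den u|.+1, r <- iota 0 `|den u|.+1]
        | is_parent u b].

Lemma find_parent_some (u b : Qhat) : find_parent u = Some b -> is_parent u b.
Proof.
rewrite /find_parent; set l := [seq _ | _ <- _, _ <- _].
case e: (filter _ l) => [|a t] //= [ab].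
have : a \in filter (is_parent u) l by rewrite e mem_head.
by rewrite mem_filter ab => /andP[].
Qed.

Lemma find_parentE (b g : Qhat) : farey_pair b g ->
  in_Q0 (oplus_iter 2 g b) ->
  parent_of (oplus_iter 2 g b) b = g /\
  find_parent (oplus_iter 2 g b) = Some b.
Proof.
move=> fp inu; set u := oplus_iter 2 g b.
have db := parent_den fp inu; have [_ _ nu du] := oplus_iter2_numden fp.
have pg : parent_of u b = g.
  by rewrite /parent_of /u nu du !addrK frac_num_den.
have pb : is_parent u b by rewrite /is_parent pg fp eqxx.
split=> //; case e: (find_parent u) => [b'|].
  have /andP[fp' /eqP u'] := find_parent_some e.
  by congr Some; apply/esym/(parent_unique fp fp' inu); rewrite u'.
move: e; rewrite /find_parent; set l := [seq _ | _ <- _, _ <- _].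
have : b \in filter (is_parent u) l.
  rewrite mem_filter pb /=; apply/allpairsP; exists (`|den b|, `|num b|)%N.
  have /and3P[/in_Qhat0_num hb _ _] := fp; have := den_ge0 g.
  move=> dg; rewrite !mem_iota /= /u du; split; [lia|by case: hb => [[? ?]|[? ? ?]]; lia|].
  rewrite -{1}(frac_num_den b); congr frac; case: hb => [[? ?]|[? ? ?]]; lia.
by case: (filter _ l).
Qed.

Fixpoint calQ_rec (n : nat) (u : Qhat) : {poly int} :=
  if u == None then 0 else
  if (u == Some 0) || (u == Some 1) then 1 else
  if n is m.+1 then
    if find_parent u is Some b then
      - dQ b * calQ_rec m (parent_of u b)
      + calQ_rec m b * calQ_rec m (oplus (parent_of u b) b)
    else 0
  else 0.

Lemma calQ_recS (n : nat) (u : Qhat) : in_Qhat0 u -> den u <= n%:Z ->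
  calQ_rec n.+1 u = calQ_rec n u.
Proof.
elim: n u => [|n IH] u inu du.
  by case: u inu du => [r|] //= _; have := denq_gt0 r; lia.
have E m : calQ_rec m.+1 u =   if u == None then 0 else
  if (u == Some 0) || (u == Some 1) then 1 else
    if find_parent u is Some b then
      - dQ b * calQ_rec m (parent_of u b)
      + calQ_rec m b * calQ_rec m (oplus (parent_of u b) b)
    else 0 by [].
rewrite !E; case: eqP => // un; case: ifP => // _.
case fu: (find_parent u) => [b|] //.
have /andP[fp /eqP pu] := find_parent_some fu.
set g := parent_of u b in fp pu *.
have iu : in_Q0 (oplus_iter 2 g b) by rewrite pu; case: (u) inu un.
have db := parent_den fp iu; have [n1 d1 n2 d2] := oplus_iter2_numden fp.
have [_ _ un0 un1] := in_Q0_num iu; rewrite pu in n2 d2 un0 un1.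
have /and3P[ib ig _] := fp; have dg := den_ge0 g.
have io : in_Qhat0 (oplus g b).
  have [/in_Qhat0_num hb /in_Qhat0_num hg] := (ib, ig).
  by apply: num_in_Qhat0; case: hb => [[? ?]|[? ? ?]];
    case: hg => [[? ?]|[? ? ?]]; lia.
have hg : den g <= n%:Z by lia.
have ho : den (oplus g b) <= n%:Z by lia.
have hb : den b <= n%:Z by lia.
by rewrite !IH.
Qed.

Lemma calQ_recE (n : nat) (u : Qhat) : in_Qhat0 u -> den u <= n%:Z ->
  calQ_rec n u = calQ_rec `|den u| u.
Proof.
move=> iu; have d0 := den_ge0 u; elim: n => [|n IH] du.
  by have -> : `|den u|%N = 0%N by lia.
have [h|h] : den u <= n%:Z \/ `|den u|%N = n.+1 by lia.
  by rewrite calQ_recS // IH.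
by rewrite h.
Qed.

Lemma is_calQ_ex : exists Q : Qhat -> {poly int}, is_calQ Q.
Proof.
exists (fun u => calQ_rec `|den u| u); split=> // b g fp iu.
have [pE fE] := find_parentE fp iu; have db := parent_den fp iu.
have [n1 d1 n2 d2] := oplus_iter2_numden fp.
have /and3P[ib ig _] := fp; have dg := den_ge0 g.
have [iu' _ u0 u1] := in_Q0_num iu.
have io : in_Qhat0 (oplus g b).
  have [/in_Qhat0_num hb /in_Qhat0_num hg] := (ib, ig).
  by apply: num_in_Qhat0; case: hb => [[? ?]|[? ? ?]];
    case: hg => [[? ?]|[? ? ?]]; lia.
set u := oplus_iter 2 g b in pE fE n2 d2 iu' u0 u1 iu *.
have [m mE] : exists m, `|den u|%N = m.+1 by exists `|den u|.-1; lia.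
have u_ne r : denq r = 1 -> u <> Some r.
  by move=> r1 ur; move: d2; rewrite ur /= r1; lia.
have bm : den b <= m%:Z by lia.
have gm : den g <= m%:Z by lia.
have om : den (oplus g b) <= m%:Z by lia.
rewrite mE /= fE pE !(calQ_recE _ bm, calQ_recE _ gm, calQ_recE _ om) //.
case: eqP => [un|_]; first by rewrite un in iu.
by do 2![case: eqP => [/u_ne|_]; first by move=> /(_ erefl)].
Qed.

(* Main.v *)
Require Import Defs.
From HB Require Import structures.
From mathcomp Require Import all_boot all_order all_algebra.
From mathcomp Require Import zify ring lra.
Import Order.TTheory GRing.Theory Num.Theory.
Local Open Scope ring_scope.

Set Implicit Arguments.
Unset Strict Implicit.
Unset Printing Implicit Defensive.

(** The theorem holds because shape parameters are quotients of values of the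
    two functions Q and d at vertices of the Stern-Brocot diagram, and in these
    terms every gluing equation is a telescoping product.

    For an edge e with mediant c, write L, R for its endpoints. Multiplicativity
    of d under mediants turns the definition of Z, with its hat and its sign nu,
    into the uniform formula
      Z(e) = - (d(R) / d(L)) * (Q(L) / Q(R))^2
    ([shapeE]), which also covers the horizontal edge, with value 1; so the
    convention z_0 = 1 is z_0 = Z(e_0). The recursion for Q preserves
      Q(c)^2 + d(L) Q(R)^2 + d(R) Q(L)^2 = Q(L) Q(R) Q(c)
    ([fricke]) when passing from an edge to either of the two edges below it.
    This relation is what makes 1 - Z factor: if e' is a lower edge of e and c'
    the mediant of e', then up to a value of d, 1 - Z(e') is a quotient of
    products of values of Q, with Q(c') in the numerator
    ([one_sub_shape_childL], [one_sub_shape_childR]).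
    Setting x = 0 in the recursion shows that all values of Q at rational
    vertices have constant term 1, so nothing here vanishes.

    Consequently, when the funnel keeps its left endpoint from e_j to e_(j+1),
    zeta(z_(j+1)) is the quotient of consecutive values of Q(R)/Q(c); when it
    keeps its right endpoint, zeta^2(z_(j+1)) is the inverse quotient for
    Q(L)/Q(c). The edges at a vertex b of the funnel are those of a maximal run
    of steps that keep b, preceded by the step that creates b and followed by
    the step that leaves it ([left_fan_indices], [right_fan_indices]). Only the
    two ends of the telescoping product survive, and they cancel against
    z_(k-1) and z_(l+1) ([left_fan], [right_fan], [upper_tunnel_fan]).

    The argument takes place in an arbitrary field F containing Z[x] through an
    injective ring morphism phi; only the last step takes F to be Q(x). *)

(** * Edges of the Stern-Brocot diagram *)

Definition apex (e : edge) : rat := mediant (edgeL e) (edgeR e).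
Definition childL (e : edge) : edge := (edgeL e, apex e).
Definition childR (e : edge) : edge := (apex e, edgeR e).

(** Edges reachable from [horizontal]: the inductive form lets the invariants
    of Q be proved by descent, and every funnel edge has it by construction. *)
Inductive stern_brocot : edge -> Prop :=
| sb_horizontal : stern_brocot horizontal
| sb_childL e : stern_brocot e -> stern_brocot (childL e)
| sb_childR e : stern_brocot e -> stern_brocot (childR e).

Lemma stern_brocot_edge e : stern_brocot e -> is_edge e.
Proof. by elim=> // f _ /mediant_edge[]. Qed.

Lemma frac_numq_denq r : Defs.frac (numq r) (denq r) = Some r.
Proof. exact: (frac_num_den (Some r)). Qed.

Lemma denq_apexL e : is_edge e -> denq (edgeL e) < denq (apex e).
Proof. by move=> /mediant_edge[_ ->]; have := denq_gt0 (edgeR e); lia. Qed.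

Lemma denq_apexR e : is_edge e -> denq (edgeR e) < denq (apex e).
Proof. by move=> /mediant_edge[_ ->]; have := denq_gt0 (edgeL e); lia. Qed.

Lemma edgeL_lt_apex e : is_edge e -> edgeL e < apex e.
Proof. by case/mediant_edge=> _ _ /and4P[]. Qed.

Lemma apex_lt_edgeR e : is_edge e -> apex e < edgeR e.
Proof. by case/mediant_edge=> _ _ _ /and4P[]. Qed.

Lemma childL_eq_horizontal e : is_edge e -> (childL e == horizontal) = false.
Proof.
move=> ee; apply/eqP=> -[_ c1]; have := denq_apexR ee.
by rewrite c1 (_ : denq 1 = 1) //; have := denq_gt0 (edgeR e); lia.
Qed.

Lemma childR_eq_horizontal e : is_edge e -> (childR e == horizontal) = false.
Proof.
move=> ee; apply/eqP=> -[c0 _]; have := denq_apexR ee.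
by rewrite c0 (_ : denq 0 = 1) //; have := denq_gt0 (edgeR e); lia.
Qed.

Lemma edge_minus_childL e : is_edge e -> edge_minus (childL e) = edgeL e.
Proof. by move=> ee; rewrite /edge_minus /= denq_apexL. Qed.

Lemma edge_minus_childR e : is_edge e -> edge_minus (childR e) = edgeR e.
Proof. by move=> ee; rewrite /edge_minus /= ltNge ltW ?denq_apexR. Qed.

Lemma hat_childL e : is_edge e -> hat (childL e) = Some (edgeR e).
Proof.
move=> ee; rewrite /hat childL_eq_horizontal // edge_minus_childL //.
rewrite /edge_plus /= denq_apexL //; have [-> -> _ _] := mediant_edge ee.
by rewrite ![_ (edgeL e) + _]addrC !addrK frac_numq_denq.
Qed.

Lemma hat_childR e : is_edge e -> hat (childR e) = Some (edgeL e).
Proof.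
move=> ee; rewrite /hat childR_eq_horizontal // edge_minus_childR //.
rewrite /edge_plus /= ltNge ltW ?denq_apexR //=.
by have [-> -> _ _] := mediant_edge ee; rewrite !addrK frac_numq_denq.
Qed.

Lemma nu_childL e : is_edge e -> nu (childL e) = -1.
Proof.
by move=> ee; rewrite /nu childL_eq_horizontal // edge_minus_childL // eqxx.
Qed.

Lemma nu_childR e : is_edge e -> nu (childR e) = 1.
Proof.
move=> ee; rewrite /nu childR_eq_horizontal // edge_minus_childR //.
by rewrite gt_eqF ?apex_lt_edgeR.
Qed.

(** * The functions d and Q *)

Lemma dQ_apex e : is_edge e ->
  dQ (Some (apex e)) = dQ (Some (edgeL e)) * dQ (Some (edgeR e)).
Proof.
move=> ee; rewrite /dQ /=; have [-> -> _ _] := mediant_edge ee.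
have [L0 _ R0 _] := edge_num ee.
have abszD (x y : int) : 0 <= x -> 0 <= y -> absz (x + y) = (absz x + absz y)%N.
  by lia.
have d0 r : 0 <= denq r by rewrite ltW ?denq_gt0.
by rewrite !abszD // !exprD; ring.
Qed.

Lemma dQ_neq0 u : dQ u != 0.
Proof. by rewrite mulf_neq0 // ?signr_eq0 // expf_neq0 // polyX_eq0. Qed.

Lemma coef0_dQ r : (dQ (Some r))`_0 = 0.
Proof.
have dr := denq_gt0 r; rewrite /dQ coef0M coefXn /=.
by rewrite (_ : (0 == _) = false)%N ?mulr0 //; lia.
Qed.

Lemma mediantC a b : mediant a b = mediant b a.
Proof. by rewrite /mediant addrC [denq a + _]addrC. Qed.

Section CalQ.
Variables (Q : Qhat -> {poly int}) (hQ : is_calQ Q).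
Local Notation q r := (Q (Some r)).
Local Notation d r := (dQ (Some r)).

(** The recursion of Q for gamma = R and beta = L: the mediant of [childL e] is
    obtained from R by adding L twice. *)
Lemma calQ_apex_childL e : is_edge e ->
  q (apex (childL e)) = q (edgeL e) * q (apex e) - d (edgeL e) * q (edgeR e).
Proof.
move=> ee; have [_ _ _ rec] := hQ; have /and4P[_ _ _ fp] := ee.
have := rec _ _ fp; rewrite /oplus_iter /= !oplusE.
rewrite (mediantC (edgeR e)) -/(apex e) (mediantC (apex e)).
rewrite -/(apex (childL e)) => -> //; first by ring.
have [_ _ eL _] := mediant_edge ee; have [_ _ ] := mediant_edge eL.
by move=> /and4P[_ _ c1 _] /and4P[c0 _ _ _]; apply/andP; split.
Qed.

Lemma calQ_apex_childR e : is_edge e ->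
  q (apex (childR e)) = q (apex e) * q (edgeR e) - d (edgeR e) * q (edgeL e).
Proof.
move=> ee; have [_ _ _ rec] := hQ; have /and4P[_ _ _ fp] := ee.
have fp' : farey_pair (Some (edgeR e)) (Some (edgeL e)).
  by move: fp => /and3P[h1 h2 h3]; rewrite /farey_pair h1 h2 distrC.
have := rec _ _ fp'; rewrite /oplus_iter /= !oplusE.
rewrite -/(apex e) -/(apex (childR e)) => -> //; first by ring.
have [_ _ _ eR] := mediant_edge ee; have [_ _ ] := mediant_edge eR.
by move=> /and4P[_ _ c1 _] /and4P[c0 _ _ _]; apply/andP; split.
Qed.

(** The recursion with gamma = oo and beta = 0; it starts the descent, as
    [horizontal] has no parent edge. *)
Lemma calQ_half : q (1 / 2) = 1.
Proof.
have [Q0 Qoo Q1 rec] := hQ.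
have := rec (Some 0) None isT; rewrite (_ : oplus_iter _ _ _ = Some (1 / 2)).
  by rewrite Q0 Qoo (_ : oplus _ _ = Some 1) ?Q1 // => -> //; ring.
by rewrite /oplus_iter /= (_ : oplus None _ = Some 1).
Qed.

(** At x = 0 the term of the recursion carrying d vanishes, so that Q becomes
    multiplicative there; this is how Q is shown not to vanish. *)
Lemma coef0_calQ e : stern_brocot e ->
  [/\ (q (edgeL e))`_0 = 1, (q (edgeR e))`_0 = 1 & (q (apex e))`_0 = 1].
Proof.
have [Q0 _ Q1 _] := hQ; elim=> [|f sf [qL qR qc]|f sf [qL qR qc]].
- by rewrite /= Q0 Q1 (_ : apex _ = 1 / 2) // calQ_half coef1.
- rewrite calQ_apex_childL ?stern_brocot_edge //.
  rewrite coefB (coef0M (dQ _)) coef0_dQ coef0M.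
  by rewrite qL qc mul0r subr0 mulr1.
- rewrite calQ_apex_childR ?stern_brocot_edge //.
  rewrite coefB (coef0M (dQ _)) coef0_dQ coef0M.
  by rewrite qR qc mul0r subr0 mulr1.
Qed.

Lemma calQ_neq0 e : stern_brocot e ->
  [/\ q (edgeL e) != 0, q (edgeR e) != 0 & q (apex e) != 0].
Proof.
move=> /coef0_calQ[hL hR hc].
by split; apply/eqP => h; [move: hL|move: hR|move: hc]; rewrite h coef0.
Qed.

(** A Markov-type invariant of the triangle below e, preserved by a Vieta jump.
    Let e' be the child that keeps the endpoint b of e and drops g. The relation
    for e' is a monic quadratic equation in Q at the mediant of e'; that for e
    says that d(b) Q(g) is a root of it, and the recursion gives the other root
    as the sum of the two roots minus d(b) Q(g). *)
Lemma fricke e : stern_brocot e ->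
  q (apex e) ^+ 2 + d (edgeL e) * q (edgeR e) ^+ 2
    + d (edgeR e) * q (edgeL e) ^+ 2
  = q (edgeL e) * q (edgeR e) * q (apex e).
Proof.
have [Q0 _ Q1 _] := hQ; elim=> [|f sf IH|f sf IH].
- rewrite (_ : apex _ = 1 / 2) // calQ_half /= Q0 Q1.
  by rewrite /dQ /=; ring.
- have ef := stern_brocot_edge sf; rewrite calQ_apex_childL //= dQ_apex //.
  apply/eqP; rewrite -subr_eq0; apply/eqP.
  (* In terms of Q on f, the relation for the child is a multiple of that for f. *)
  transitivity (d (edgeL f) * (q (apex f) ^+ 2 + d (edgeL f) * q (edgeR f) ^+ 2
    + d (edgeR f) * q (edgeL f) ^+ 2 - q (edgeL f) * q (edgeR f) * q (apex f))).
    by ring.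
  by rewrite IH subrr mulr0.
- have ef := stern_brocot_edge sf; rewrite calQ_apex_childR //= dQ_apex //.
  apply/eqP; rewrite -subr_eq0; apply/eqP.
  transitivity (d (edgeR f) * (q (apex f) ^+ 2 + d (edgeL f) * q (edgeR f) ^+ 2
    + d (edgeR f) * q (edgeL f) ^+ 2 - q (edgeL f) * q (edgeR f) * q (apex f))).
    by ring.
  by rewrite IH subrr mulr0.
Qed.
End CalQ.

(** * Telescoping and the function zeta *)

Lemma zetaE (F : fieldType) (t : F) : zeta t = (1 - t)^-1.
Proof. exact: div1r. Qed.

Lemma zeta2E (F : fieldType) (t : F) :
  t != 0 -> t != 1 -> zeta2 t = - (1 - t) / t.
Proof.
move=> t0 t1; have s0 : 1 - t != 0 by rewrite subr_eq0 eq_sym.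
rewrite /zeta2 /zeta (_ : 1 - 1 / (1 - t) = - t / (1 - t)); last by field.
by field; rewrite s0 oppr_eq0 t0.
Qed.

(** The first factor of a fan is not of the telescoping form, hence is kept
    apart. *)
Lemma fan_product (F : fieldType) (w u : nat -> F) k l : (k <= l)%N ->
  (forall j, (k <= j <= l)%N -> u j != 0) ->
  (forall j, (k <= j < l)%N -> w j.+1 = u j.+1 / u j) ->
  \prod_(k <= j < l.+1) w j = w k * (u l / u k).
Proof.
move=> kl u0 wu; rewrite big_nat_recl //; congr (_ * _).
rewrite (eq_big_nat _ _ wu); move: kl; rewrite leq_eqVlt => /orP[/eqP kl|kl].
  by rewrite kl big_geq // divff // u0 // kl leqnn.
by rewrite telescope_prodf // => j jkl; apply: u0; lia.
Qed.

(** * Shape parameters *)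

Section FunctionField.
Variables (Q : Qhat -> {poly int}) (hQ : is_calQ Q).
Variables (F : fieldType) (phi : {rmorphism {poly int} -> F}).
Hypothesis phi_inj : injective phi.
Local Notation q r := (phi (Q (Some r))).
Local Notation d r := (phi (dQ (Some r))).

(** [shapeZ] with the embedding of Z[x] in Q(x) replaced by phi. *)
Definition shape (e : edge) : F :=
  - phi (dQ (hat e)) ^ (- nu e) * (q (edgeL e) / q (edgeR e)) ^+ 2.

Let phi_neq0 (p : {poly int}) : p != 0 -> phi p != 0.
Proof. by apply: contra_neq => h; apply: phi_inj; rewrite h rmorph0. Qed.

Let phi_dQ_neq0 u : phi (dQ u) != 0. Proof. exact/phi_neq0/dQ_neq0. Qed.

Lemma phi_calQ_neq0 e : stern_brocot e ->
  [/\ q (edgeL e) != 0, q (edgeR e) != 0 & q (apex e) != 0].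
Proof. by move=> /(calQ_neq0 hQ)[? ? ?]; split; exact: phi_neq0. Qed.

Lemma phi_dQ_apex e : is_edge e -> d (apex e) = d (edgeL e) * d (edgeR e).
Proof. by move=> /dQ_apex ->; rewrite (rmorphM phi (dQ _)). Qed.

Lemma phi_calQ_apex_childL e : is_edge e ->
  q (apex (childL e)) = q (edgeL e) * q (apex e) - d (edgeL e) * q (edgeR e).
Proof.
move=> /(calQ_apex_childL hQ) ->.
by rewrite rmorphB (rmorphM phi (Q _)) (rmorphM phi (dQ _)).
Qed.

Lemma phi_calQ_apex_childR e : is_edge e ->
  q (apex (childR e)) = q (apex e) * q (edgeR e) - d (edgeR e) * q (edgeL e).
Proof.
move=> /(calQ_apex_childR hQ) ->.
by rewrite rmorphB (rmorphM phi (Q _)) (rmorphM phi (dQ _)).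
Qed.

Lemma phi_fricke e : stern_brocot e ->
  q (apex e) ^+ 2 + d (edgeL e) * q (edgeR e) ^+ 2
    + d (edgeR e) * q (edgeL e) ^+ 2
  = q (edgeL e) * q (edgeR e) * q (apex e).
Proof.
move=> /(fricke hQ); move: (dQ (Some (edgeL e))) (dQ (Some (edgeR e))) => u v.
by move=> /(congr1 phi); rewrite !(rmorphD, rmorphM, rmorphXn).
Qed.

(** This is why the convention z_0 = 1 of the gluing equations fits the others:
    d(oo) = -1 makes Z(e_0) equal to 1. *)
Lemma shape_horizontal : shape horizontal = 1.
Proof.
have [Q0 _ Q1 _] := hQ; rewrite /shape /nu /hat eqxx /= Q0 Q1 rmorph1.
rewrite (_ : dQ None = -1); last by rewrite /dQ /=; ring.
by rewrite rmorphN1 -invr_expz expr1z invrN invr1 opprK !mul1r expr1n.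
Qed.

(** With e^+ = hat (+) e^-, multiplicativity of d gives
    d(hat) = d(e^+) / d(e^-), and the exponent - nu turns this into d(R) / d(L)
    for both orientations. *)
Lemma shapeE e : stern_brocot e ->
  shape e = - (d (edgeR e) / d (edgeL e)) * (q (edgeL e) / q (edgeR e)) ^+ 2.
Proof.
case=> [|f sf|f sf].
- have [Q0 _ Q1 _] := hQ; rewrite shape_horizontal /= Q0 Q1.
  rewrite (_ : d 1 = - d 0) ?rmorph1; last first.
    by rewrite -rmorphN; congr (phi _); rewrite /dQ /=; ring.
  by rewrite (mulNr (d 0)) (@divff _ (d 0)) // opprK !mul1r invr1 expr1n.
- have ef := stern_brocot_edge sf.
  rewrite /shape hat_childL // nu_childL // opprK expr1z /= phi_dQ_apex //.
  by congr (_ * _); field.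
- have ef := stern_brocot_edge sf.
  rewrite /shape hat_childR // nu_childR //= phi_dQ_apex //.
  by rewrite -invr_expz expr1z; congr (_ * _); field; rewrite !phi_dQ_neq0.
Qed.

Lemma shape_neq0 e : stern_brocot e -> shape e != 0.
Proof.
move=> se; have [qL qR _] := phi_calQ_neq0 se; rewrite shapeE //.
by rewrite mulf_neq0 ?expf_neq0 ?oppr_eq0 // mulf_neq0 ?invr_eq0.
Qed.

(** By [fricke] for e, Q(c)^2 + d(R) Q(L)^2 = Q(R) (Q(L) Q(c) - d(L) Q(R)), and
    the recursion recognizes the last factor as Q at the mediant of the
    child. *)
Lemma one_sub_shape_childL e : stern_brocot e ->
  1 - shape (childL e) =
  q (edgeR e) * q (apex (childL e)) / q (apex e) ^+ 2.
Proof.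
move=> se; have ee := stern_brocot_edge se; have [qL qR qc] := phi_calQ_neq0 se.
have := phi_fricke se; rewrite shapeE; last exact: sb_childL.
rewrite phi_calQ_apex_childL //= phi_dQ_apex //.
move: (phi_dQ_neq0 (Some (edgeL e))) (phi_dQ_neq0 (Some (edgeR e))) qL qR qc.
move: (q (edgeL e)) (q (edgeR e)) (q (apex e)) (d (edgeL e)) (d (edgeR e)).
move=> a b c u v u0 v0 a0 b0 c0 h.
apply/eqP; rewrite -subr_eq0; apply/eqP.
(* The difference of the two sides is a multiple of the Fricke relation h. *)
transitivity ((c ^+ 2 + u * b ^+ 2 + v * a ^+ 2 - a * b * c) / c ^+ 2).
  by field; rewrite u0 c0.
by rewrite h subrr mul0r.
Qed.

Lemma one_sub_shape_childR e : stern_brocot e ->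
  1 - shape (childR e) =
  q (edgeL e) * q (apex (childR e)) / (d (edgeL e) * q (edgeR e) ^+ 2).
Proof.
move=> se; have ee := stern_brocot_edge se; have [qL qR qc] := phi_calQ_neq0 se.
have := phi_fricke se; rewrite shapeE; last exact: sb_childR.
rewrite phi_calQ_apex_childR //= phi_dQ_apex //.
move: (phi_dQ_neq0 (Some (edgeL e))) (phi_dQ_neq0 (Some (edgeR e))) qL qR qc.
move: (q (edgeL e)) (q (edgeR e)) (q (apex e)) (d (edgeL e)) (d (edgeR e)).
move=> a b c u v u0 v0 a0 b0 c0 h.
apply/eqP; rewrite -subr_eq0; apply/eqP.
transitivity ((c ^+ 2 + u * b ^+ 2 + v * a ^+ 2 - a * b * c) / (u * b ^+ 2)).
  by field; rewrite u0 v0 b0.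
by rewrite h subrr mul0r.
Qed.

Lemma shape_childL_neq1 e : stern_brocot e -> shape (childL e) != 1.
Proof.
move=> se; have [_ qR qc] := phi_calQ_neq0 se.
have [_ _ qc1] := phi_calQ_neq0 (sb_childL se).
rewrite eq_sym -subr_eq0 one_sub_shape_childL //.
by rewrite mulf_neq0 ?invr_eq0 ?expf_neq0 // mulf_neq0.
Qed.

Lemma shape_childR_neq1 e : stern_brocot e -> shape (childR e) != 1.
Proof.
move=> se; have [qL qR qc] := phi_calQ_neq0 se.
have [_ _ qc1] := phi_calQ_neq0 (sb_childR se).
rewrite eq_sym -subr_eq0 one_sub_shape_childR //.
by rewrite mulf_neq0 ?invr_eq0 ?mulf_neq0 ?expf_neq0.
Qed.

(** The potentials whose consecutive quotients are the factors of the gluing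
    equations: [ratioR] along edges sharing a left endpoint, [ratioL] along
    edges sharing a right endpoint. *)
Definition ratioL (e : edge) : F := q (edgeL e) / q (apex e).
Definition ratioR (e : edge) : F := q (edgeR e) / q (apex e).

Lemma ratioL_neq0 e : stern_brocot e -> ratioL e != 0.
Proof. by case/phi_calQ_neq0=> ? ? ?; rewrite mulf_neq0 ?invr_eq0. Qed.

Lemma ratioR_neq0 e : stern_brocot e -> ratioR e != 0.
Proof. by case/phi_calQ_neq0=> ? ? ?; rewrite mulf_neq0 ?invr_eq0. Qed.

Lemma zeta_childL e : stern_brocot e ->
  zeta (shape (childL e)) = ratioR (childL e) / ratioR e.
Proof.
move=> se; have [_ qR qc] := phi_calQ_neq0 se.
have [_ _ qc1] := phi_calQ_neq0 (sb_childL se).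
rewrite zetaE one_sub_shape_childL // /ratioR /=; field.
by rewrite qR qc qc1.
Qed.

(** The first factor of the fan of a left vertex, which is the mediant of e. It
    contributes, besides [ratioR], the boundary term that is squared against
    Z(e) in [left_fan]. *)
Lemma zeta_childR e : stern_brocot e ->
  zeta (shape (childR e)) =
  d (edgeL e) * (q (edgeR e) / q (edgeL e)) * ratioR (childR e).
Proof.
move=> se; have [qL qR qc] := phi_calQ_neq0 se.
have [_ _ qc1] := phi_calQ_neq0 (sb_childR se).
rewrite zetaE one_sub_shape_childR // /ratioR /=; field.
by rewrite qR qL qc1 phi_dQ_neq0.
Qed.

Lemma zeta2_childR e : stern_brocot e ->
  zeta2 (shape (childR e)) = (ratioL (childR e))^-1 / (ratioL e)^-1.
Proof.
move=> se; have ee := stern_brocot_edge se; have [qL qR qc] := phi_calQ_neq0 se.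
have sr := sb_childR se; have [_ _ qc1] := phi_calQ_neq0 sr.
rewrite zeta2E ?shape_neq0 ?shape_childR_neq1 // one_sub_shape_childR //.
rewrite shapeE // /ratioL /= phi_dQ_apex //; field.
by rewrite qL qR qc qc1 !phi_dQ_neq0 oppr_eq0 oner_eq0.
Qed.

(** The mirror image of [zeta_childR]: the first factor of the fan of a right
    vertex. *)
Lemma zeta2_childL e : stern_brocot e ->
  zeta2 (shape (childL e)) =
  q (edgeR e) / (d (edgeR e) * q (edgeL e)) * (ratioL (childL e))^-1.
Proof.
move=> se; have ee := stern_brocot_edge se; have [qL qR qc] := phi_calQ_neq0 se.
have sr := sb_childL se; have [_ _ qc1] := phi_calQ_neq0 sr.
rewrite zeta2E ?shape_neq0 ?shape_childL_neq1 // one_sub_shape_childL //.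
rewrite shapeE // /ratioL /= phi_dQ_apex //; field.
by rewrite qL qc qc1 oppr_eq0 !phi_dQ_neq0.
Qed.

(** The shape parameter of the edge that closes a fan, in terms of the last
    value of the telescoping potential. *)
Lemma shape_childL_ratio e : stern_brocot e ->
  shape (childL e) = - d (edgeR e) * ratioL e ^+ 2.
Proof.
move=> se; have ee := stern_brocot_edge se; have [qL qR qc] := phi_calQ_neq0 se.
rewrite shapeE; last exact: sb_childL.
by rewrite /ratioL /= phi_dQ_apex //; field; rewrite qc phi_dQ_neq0.
Qed.

Lemma shape_childR_ratio e : stern_brocot e ->
  shape (childR e) = - (d (edgeL e) * ratioR e ^+ 2)^-1.
Proof.
move=> se; have ee := stern_brocot_edge se; have [qL qR qc] := phi_calQ_neq0 se.
rewrite shapeE; last exact: sb_childR.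
by rewrite /ratioR /= phi_dQ_apex //; field; rewrite qR qc !phi_dQ_neq0.
Qed.

(** * Fans of the funnel *)

Section Funnel.
Variables (alpha : rat) (n : nat).
Hypotheses (alpha01 : 0 < alpha < 1) (hn : funnel_last alpha n.+1).
Local Notation e := (funnel_edge alpha).

Lemma funnel_edge_sb j : stern_brocot (e j).
Proof.
elim: j => [|j IH]; first exact: sb_horizontal.
by rewrite /=; case: ifP => _; [exact: sb_childL | exact: sb_childR].
Qed.

Lemma funnel_straddle j : (j <= n.+1)%N -> edgeL (e j) < alpha < edgeR (e j).
Proof.
move=> jn; have [] // := @funnel_edgeP alpha j alpha01.
by case: hn => _ h i ij; apply: h; lia.
Qed.

Lemma funnel_step_edgeL j :
  edgeL (e j.+1) = edgeL (e j) -> e j.+1 = childL (e j).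
Proof.
rewrite /= -/(apex (e j)); case: ifP => // _ /= h.
by have := edgeL_lt_apex (stern_brocot_edge (funnel_edge_sb j)); rewrite h ltxx.
Qed.

Lemma funnel_step_edgeR j :
  edgeR (e j.+1) = edgeR (e j) -> e j.+1 = childR (e j).
Proof.
rewrite /= -/(apex (e j)); case: ifP => // _ /= h.
by have := apex_lt_edgeR (stern_brocot_edge (funnel_edge_sb j)); rewrite h ltxx.
Qed.

Lemma funnel_step_edgeL_neq j :
  edgeL (e j.+1) != edgeL (e j) -> e j.+1 = childR (e j).
Proof. by rewrite /=; case: ifP => //= _; rewrite eqxx. Qed.

Lemma funnel_step_edgeR_neq j :
  edgeR (e j.+1) != edgeR (e j) -> e j.+1 = childL (e j).
Proof. by rewrite /=; case: ifP => //= _; rewrite eqxx. Qed.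

Lemma funnel_edgeL_le i j : (i <= j)%N -> edgeL (e i) <= edgeL (e j).
Proof.
move: i j.
apply: (homo_leq (f := fun j => edgeL (e j)) (r := fun x y => x <= y)).
- exact: lexx.
- exact: le_trans.
move=> j.
have := edgeL_lt_apex (stern_brocot_edge (funnel_edge_sb j)).
by rewrite /=; case: ifP => //= _ /ltW.
Qed.

Lemma funnel_edgeR_le i j : (i <= j)%N -> edgeR (e j) <= edgeR (e i).
Proof.
move: i j.
apply: (homo_leq (f := fun j => edgeR (e j)) (r := fun x y => y <= x)).
- exact: lexx.
- by move=> y x z yx zy; exact: le_trans yx.
move=> j.
have := apex_lt_edgeR (stern_brocot_edge (funnel_edge_sb j)).
by rewrite /=; case: ifP => //= _ /ltW.
Qed.

Lemma endpoint_left b j : (j <= n.+1)%N -> b < alpha ->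
  endpoint b (e j) = (b == edgeL (e j)).
Proof.
move=> /funnel_straddle /andP[_ aR] ba; rewrite /endpoint.
by rewrite [b == edgeR _]lt_eqF ?orbF // (lt_trans ba).
Qed.

Lemma endpoint_right b j : (j <= n.+1)%N -> alpha < b ->
  endpoint b (e j) = (b == edgeR (e j)).
Proof.
move=> /funnel_straddle /andP[La _] ab; rewrite /endpoint.
by rewrite [b == edgeL _]gt_eqF // (lt_trans La).
Qed.

(** The step to e_(i+1) creates the vertex b = c_i, the steps up to e_l keep it
    and the step to e_(l+1) leaves it. The product telescopes to
    d(L_i) (Q(R_i) / Q(L_i)) [ratioR (e l)], whose square cancels
    Z(e_i) Z(e_(l+1)) because d(b) = d(L_i) d(R_i). *)
Lemma left_fan i l : (i < l)%N -> e i.+1 = childR (e i) ->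
  edgeL (e l) = edgeL (e i.+1) -> e l.+1 = childR (e l) ->
  shape (e i) * shape (e l.+1)
    * (\prod_(i.+1 <= j < l.+1) zeta (shape (e j))) ^+ 2 = 1.
Proof.
move=> il ei Ll el; have s j := funnel_edge_sb j.
have Lj j : (i < j <= l)%N -> edgeL (e j) = apex (e i).
  move=> /andP[ij jl]; apply/le_anti.
  have := funnel_edgeL_le ij; have := funnel_edgeL_le jl.
  by rewrite Ll ei /= => -> ->.
rewrite (@fan_product _ _ (fun j => ratioR (e j))) //; first last.
- move=> j jl; rewrite funnel_step_edgeL ?zeta_childL //.
  by rewrite !Lj //; lia.
- by move=> j _; apply: ratioR_neq0.
rewrite ei zeta_childR // -ei el shape_childR_ratio // shapeE //.
rewrite (Lj l) ?leqnn ?il // phi_dQ_apex ?stern_brocot_edge //.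
have [qL qR _] := phi_calQ_neq0 (s i).
have r := ratioR_neq0 (s l); have r' := ratioR_neq0 (s i.+1).
by field; rewrite qL qR r r' !phi_dQ_neq0.
Qed.

Lemma right_fan i l : (i < l)%N -> e i.+1 = childL (e i) ->
  edgeR (e l) = edgeR (e i.+1) -> e l.+1 = childL (e l) ->
  shape (e i) * shape (e l.+1)
    * (\prod_(i.+1 <= j < l.+1) zeta2 (shape (e j))) ^+ 2 = 1.
Proof.
move=> il ei Rl el; have s j := funnel_edge_sb j.
have Rj j : (i < j <= l)%N -> edgeR (e j) = apex (e i).
  move=> /andP[ij jl]; apply/le_anti.
  have := funnel_edgeR_le ij; have := funnel_edgeR_le jl.
  by rewrite Rl ei /= => -> ->.
rewrite (@fan_product _ _ (fun j => (ratioL (e j))^-1)) //; first last.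
- move=> j jl; rewrite funnel_step_edgeR ?zeta2_childR //.
  by rewrite !Rj //; lia.
- by move=> j _; rewrite invr_eq0 ratioL_neq0.
rewrite ei zeta2_childL // -ei el shape_childL_ratio // shapeE //.
rewrite (Rj l) ?leqnn ?il // phi_dQ_apex ?stern_brocot_edge //.
have [qL qR _] := phi_calQ_neq0 (s i).
have r := ratioL_neq0 (s l); have r' := ratioL_neq0 (s i.+1).
by field; rewrite qL qR r r' oner_eq0 !phi_dQ_neq0.
Qed.

(** Here the fan is that of 0, which no step creates: the product starts with a
    step that keeps 0, and z_1 closes the fan of 1 above it. The sign comes from
    d(1) = - d(0). *)
Lemma upper_tunnel_fan l :
  (0 < l)%N -> edgeL (e l) = 0 -> e l.+1 = childR (e l) ->
  e 1 = childL horizontal ->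
  shape (e 1) * shape (e l.+1)
    * (\prod_(1 <= j < l.+1) zeta (shape (e j))) ^+ 2 = -1.
Proof.
move=> l0 Ll el e1; have s j := funnel_edge_sb j.
have Lj j : (j <= l)%N -> edgeL (e j) = 0.
  move=> jl; apply/le_anti; have := funnel_edgeL_le jl.
  by rewrite Ll => ->; apply: (funnel_edgeL_le (leq0n j)).
rewrite (@fan_product _ _ (fun j => ratioR (e j))) //; first last.
- move=> j jl; rewrite funnel_step_edgeL ?zeta_childL //.
  by rewrite !Lj //; lia.
- by move=> j _; apply: ratioR_neq0.
have [Q0 _ Q1 _] := hQ; have s0 := sb_horizontal.
rewrite el shape_childR_ratio // (Lj l) // e1.
rewrite zeta_childL // shape_childL_ratio //.
rewrite -e1 /ratioL /ratioR [apex horizontal](_ : _ = 1 / 2) //= Q0 Q1.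
rewrite (calQ_half hQ) rmorph1 -/(ratioR (e 1)) -/(ratioR (e l)).
have r := ratioR_neq0 (s l); have r' := ratioR_neq0 (s 1%N).
rewrite (_ : d 1 = - d 0); last first.
  by rewrite -rmorphN; congr (phi _); rewrite /dQ /=; ring.
by field; rewrite r r' !phi_dQ_neq0 oner_eq0.
Qed.

(** Below alpha a vertex can only be a left endpoint, so the smallest index
    follows the step that creates b. If the largest index were n, then the last
    edge would arise by leaving b and have hat b; hence l < n. *)
Lemma left_fan_indices b k l : b < alpha -> ~~ endpoint b (e 0) ->
  ~~ endpoint b (e n.+1) -> Some b != hat (e n.+1) ->
  smallest_index n (fun j => endpoint b (e j)) k ->
  largest_index n (fun j => endpoint b (e j)) l ->
  exists i, [/\ k = i.+1, (i < l < n)%N, e i.+1 = childR (e i),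
    edgeL (e l) = edgeL (e i.+1) & e l.+1 = childR (e l)].
Proof.
move=> ba b0 bn bhat [/andP[k1 kn] bk kmin] [/andP[l1 ln] bl lmax].
case: k k1 kn bk kmin => // i _ kn bk kmin.
have bi : ~~ endpoint b (e i).
  by case: i kn kmin {bk} => // i kn kmin; apply/negP => /kmin; lia.
have bl' : ~~ endpoint b (e l.+1).
  have [->//|ln'] : l = n \/ (l < n)%N by lia.
  by apply/negP => /lmax; lia.
have il : (i < l)%N by apply: kmin; lia.
move: bi bk bl bl'; rewrite !endpoint_left //; try lia.
move=> bi /eqP bk /eqP bl bl'.
have el : e l.+1 = childR (e l).
  by apply: funnel_step_edgeL_neq; rewrite -bl eq_sym.
exists i; split=> //.
- rewrite il ltn_neqAle ln andbT; apply: contraNneq bhat => <-.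
  by rewrite el hat_childR ?bl // stern_brocot_edge //; exact: funnel_edge_sb.
- by apply: funnel_step_edgeL_neq; rewrite -bk.
- by rewrite -bl.
Qed.

Lemma right_fan_indices b k l : alpha < b -> ~~ endpoint b (e 0) ->
  ~~ endpoint b (e n.+1) -> Some b != hat (e n.+1) ->
  smallest_index n (fun j => endpoint b (e j)) k ->
  largest_index n (fun j => endpoint b (e j)) l ->
  exists i, [/\ k = i.+1, (i < l < n)%N, e i.+1 = childL (e i),
    edgeR (e l) = edgeR (e i.+1) & e l.+1 = childL (e l)].
Proof.
move=> ba b0 bn bhat [/andP[k1 kn] bk kmin] [/andP[l1 ln] bl lmax].
case: k k1 kn bk kmin => // i _ kn bk kmin.
have bi : ~~ endpoint b (e i).
  by case: i kn kmin {bk} => // i kn kmin; apply/negP => /kmin; lia.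
have bl' : ~~ endpoint b (e l.+1).
  have [->//|ln'] : l = n \/ (l < n)%N by lia.
  by apply/negP => /lmax; lia.
have il : (i < l)%N by apply: kmin; lia.
move: bi bk bl bl'; rewrite !endpoint_right //; try lia.
move=> bi /eqP bk /eqP bl bl'.
have el : e l.+1 = childL (e l).
  by apply: funnel_step_edgeR_neq; rewrite -bl eq_sym.
exists i; split=> //.
- rewrite il ltn_neqAle ln andbT; apply: contraNneq bhat => <-.
  by rewrite el hat_childL ?bl // stern_brocot_edge //; exact: funnel_edge_sb.
- by apply: funnel_step_edgeR_neq; rewrite -bk.
- by rewrite -bl.
Qed.

(** This turns the index of the upper tunnel equation into the end of the run of
    steps that keep the left endpoint 0: from e_1 on, 0 is the only vertex of
    denominator 1 on the edges that contain it. *)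
Lemma edge_minus_eq0 j : (0 < j <= n.+1)%N ->
  (edge_minus (e j) == 0) = (edgeL (e j) == 0).
Proof.
case: j => // j jn; have /andP[_ aR] := funnel_straddle jn.
have R0 : edgeR (e j.+1) != 0.
  by rewrite gt_eqF // (lt_trans _ aR); case/andP: alpha01.
have se := funnel_edge_sb j.
move: R0; rewrite /= -/(apex (e j)); case: ifP => _ R0.
  by rewrite edge_minus_childL ?stern_brocot_edge.
rewrite edge_minus_childR ?stern_brocot_edge // (negPf R0) /=.
apply/esym/gt_eqF.
apply: le_lt_trans (edgeL_lt_apex (stern_brocot_edge se)).
exact: (funnel_edgeL_le (leq0n j)).
Qed.

Lemma upper_tunnel_index l : ~~ endpoint 0 (e n.+1) -> Some 0 != hat (e n.+1) ->
  largest_index n (fun j => edge_minus (e j) == 0) l ->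
  [/\ (0 < l < n)%N, edgeL (e l) = 0 & e l.+1 = childR (e l)].
Proof.
move=> bn bhat [/andP[l1 ln] bl lmax].
move: bl; rewrite edge_minus_eq0 => [/eqP bl|]; last by lia.
have bl' : edgeL (e l.+1) != 0.
  have [->|ln'] : l = n \/ (l < n)%N by lia.
    by apply: contraNneq bn; rewrite /endpoint => ->; rewrite eqxx.
  by rewrite -edge_minus_eq0; [apply/negP => /lmax|]; lia.
have el : e l.+1 = childR (e l) by apply: funnel_step_edgeL_neq; rewrite bl.
split=> //; rewrite l1 ltn_neqAle ln andbT; apply: contraNneq bhat => <-.
by rewrite el hat_childR ?bl // stern_brocot_edge //; exact: funnel_edge_sb.
Qed.

Lemma shape_gluing_solution (z : nat -> F) : alpha < 1 / 2 ->
  (forall j, (1 <= j <= n)%N -> z j = shape (e j)) -> gluing_solution alpha n z.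
Proof.
move=> alpha_half hz.
rewrite /gluing_solution; set z' := fun j : nat => _.
have zE j : (j <= n)%N -> z' j = shape (e j).
  by case: j => [|j] jn; [rewrite shape_horizontal | rewrite /z' /= hz].
have prodE (g : F -> F) k l : (l <= n)%N ->
    \prod_(k <= j < l.+1) g (z' j) = \prod_(k <= j < l.+1) g (shape (e j)).
  by move=> ln; apply: eq_big_nat => j jl; rewrite zE //; lia.
split.
- case=> // j jn; rewrite hz // shape_neq0; last exact: funnel_edge_sb.
  split=> //; have se := funnel_edge_sb j; rewrite /= -/(apex _).
  by case: ifP => _; [exact: shape_childL_neq1 | exact: shape_childR_neq1].
- move=> b k l b0 bn bhat hk hl; split=> -[j jn bj].
    have ba : b < alpha by rewrite bj; case/andP: (funnel_straddle jn).
    have [i [-> il ei Ll el]] := left_fan_indices ba b0 bn bhat hk hl.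
    by rewrite prodE ?zE ?left_fan //=; lia.
  have ba : alpha < b by rewrite bj; case/andP: (funnel_straddle jn).
  have [i [-> il ei Rl el]] := right_fan_indices ba b0 bn bhat hk hl.
  by rewrite prodE ?zE ?right_fan //=; lia.
- move=> l bn bhat hl; have [l0 Ll el] := upper_tunnel_index bn bhat hl.
  have e1 : e 1 = childL horizontal by rewrite /= alpha_half.
  by rewrite prodE ?zE ?upper_tunnel_fan //; lia.
Qed.
End Funnel.
End FunctionField.

(** * The field of rational functions *)

HB.instance Definition _ := GRing.RMorphism.copy toQx
  (@FracField.tofrac {poly rat} \o map_poly (intr : int -> rat)).

Lemma toQx_inj : injective toQx.
Proof.
move=> p r /eqP; rewrite tofrac_eq => /eqP; apply: map_inj_poly => //.
exact: intr_inj.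
Qed.

Theorem theorem4p18 (Q : Qhat -> {poly int}) (hQ : is_calQ Q)
    (alpha : rat) (alpha_range : 0 < alpha < 1 / 2) (alpha_ne : alpha <> 1 / 3)
    (n : nat) (hn : funnel_last alpha n.+1) (z : nat -> Qx)
    (hz : forall j : nat, (1 <= j <= n)%N ->
            z j = shapeZ Q (funnel_edge alpha j)) :
  gluing_solution alpha n z.
Proof.
have /andP[a0 a1] := alpha_range.
apply: (shape_gluing_solution hQ toQx_inj _ hn a1 hz).
by rewrite a0 /=; lra.
Qed.
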